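(* For any finite simple undirected graph $G$, $\text{2-}\eta_{P+I}(G)\leq \mathrm{v}(G)-\beta(G)-\mathrm{c}(G)$.
   Context: $P(G)$ is the parity Laplacian of $G$: the $\mathbb{F}_2$-matrix obtained by reducing $L(G)=D(G)-A(G)$ modulo $2$ (diagonal entries are degrees mod 2, off-diagonal entries are adjacency entries); $I$ is the identity matrix; $\text{2-}\eta_{P+I}(G)$ is the dimension of the kernel of $P(G)+I$ over $\mathbb{F}_2$. $\mathrm{v}(G)$ and $\mathrm{c}(G)$ are the numbers of vertices and connected components. The edge space is the $\mathbb{F}_2$-vector space of subsets of $E(G)$ under symmetric difference; the cycle space consists of edge sets in which every vertex has even degree; the cut space consists of the edge sets $\{uv\in E(G): u\in S, v\notin S\}$, $S\subseteq V(G)$; the bicycle space is their intersection and $\beta(G)$ is its dimension. *)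

(* Defs.v *)
From HB Require Import structures.
From mathcomp Require Import all_boot all_order all_algebra.

Set Implicit Arguments.
Unset Strict Implicit.
Unset Printing Implicit Defensive.

Import GRing.Theory.
Local Open Scope ring_scope.

Record sgraph (T : finType) := SGraph {
  adj :> rel T;
  adj_sym : symmetric adj;
  adj_irr : irreflexive adj }.

Definition num_vertices (T : finType) (G : sgraph T) : nat := #|T|.

(* [n_comp] counts classes of [connect (adj G)], which is an equivalence since
   [adj G] is symmetric. *)
Definition num_components (T : finType) (G : sgraph T) : nat :=
  n_comp (adj G) predT.

Definition degree (T : finType) (G : sgraph T) (u : T) : nat :=
  #|[set v | adj G u v]|.

(* Rows and columns are indexed by vertices through [enum_val]. *)
Definition degree_mx (T : finType) (G : sgraph T) : 'M[int]_#|T| :=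
  diag_mx (\row_i (degree G (enum_val i))%:Z).

Definition adjacency_mx (T : finType) (G : sgraph T) : 'M[int]_#|T| :=
  \matrix_(i, j) (adj G (enum_val i) (enum_val j))%:Z.

Definition laplacian (T : finType) (G : sgraph T) : 'M[int]_#|T| :=
  degree_mx G - adjacency_mx G.

Definition parity_laplacian (T : finType) (G : sgraph T) : 'M['F_2]_#|T| :=
  map_mx (fun z : int => z%:~R) (laplacian G).

(* [kermx] is a left kernel; transposing gives the dimension of
   {x | M *m x = 0}. *)
Definition nullity (F : fieldType) (n : nat) (M : 'M[F]_n) : nat :=
  \rank (kermx M^T).

Definition nullity2_PI (T : finType) (G : sgraph T) : nat :=
  nullity (parity_laplacian G + 1%:M).

Definition is_edge (T : finType) (G : sgraph T) (A : {set T}) : bool :=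
  [exists u, exists v, adj G u v && (A == [set u; v])].

Definition edge (T : finType) (G : sgraph T) : finType :=
  {A : {set T} | is_edge G A}.

(* Sets of edges under symmetric difference, encoded by their characteristic
   vectors; see [edge_support_vec], [edge_vec_support] and
   [edge_support_add]. *)
Definition edge_space (T : finType) (G : sgraph T) : vectType 'F_2 :=
  {ffun edge G -> ('F_2)^o}.

Definition edge_vec (T : finType) (G : sgraph T) (X : {set edge G}) :
  edge_space G := [ffun f => (f \in X)%:R].

Definition edge_support (T : finType) (G : sgraph T) (x : edge_space G) :
  {set edge G} := [set f | (x : {ffun edge G -> ('F_2)^o}) f != 0].

Definition even_edge_set (T : finType) (G : sgraph T) (X : {set edge G}) :
  bool := [forall v : T, ~~ odd #|[set f in X | v \in val f]|].

Definition cut (T : finType) (G : sgraph T) (S : {set T}) : {set edge G} :=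
  [set f | [exists u, exists v,
     [&& val f == [set u; v], u \in S & v \notin S]]].

Definition is_cut (T : finType) (G : sgraph T) (X : {set edge G}) : bool :=
  [exists S : {set T}, X == cut G S].

(* The generating families below are already subspaces, so taking the span adds
   nothing: see [mem_cycle_space] and [mem_cut_space]. *)
Definition cycle_space (T : finType) (G : sgraph T) : {vspace edge_space G} :=
  <<[seq edge_vec X | X <- enum (@even_edge_set T G)]>>%VS.

Definition cut_space (T : finType) (G : sgraph T) : {vspace edge_space G} :=
  <<[seq edge_vec X | X <- enum (@is_cut T G)]>>%VS.

Definition bicycle_space (T : finType) (G : sgraph T) :
  {vspace edge_space G} := (cycle_space G :&: cut_space G)%VS.

Definition bicycle_dim (T : finType) (G : sgraph T) : nat :=
  \dim (bicycle_space G).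

Definition symdiff (I : finType) (X Y : {set I}) : {set I} :=
  (X :\: Y) :|: (Y :\: X).

Lemma F2_cases (a : 'F_2) : a = (a != 0)%:R.
Proof. by case: a => [[|[|//]] i]; apply/val_inj. Qed.

Lemma edge_support_vec (T : finType) (G : sgraph T) (X : {set edge G}) :
  edge_support (edge_vec X) = X.
Proof. by apply/setP => f; rewrite inE ffunE; case: (f \in X). Qed.

Lemma edge_vec_support (T : finType) (G : sgraph T) (x : edge_space G) :
  edge_vec (edge_support x) = x.
Proof.
by apply/ffunP => f; rewrite ffunE inE -F2_cases.
Qed.

Lemma edge_support_add (T : finType) (G : sgraph T) (x y : edge_space G) :
  edge_support (x + y) = symdiff (edge_support x) (edge_support y).
Proof.
apply/setP => f; rewrite !inE ffunE.
rewrite [in LHS](F2_cases (x f)) [in LHS](F2_cases (y f)).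
by case: (x f != 0); case: (y f != 0).
Qed.

Lemma mem_span_edge_vec (T : finType) (G : sgraph T)
    (p : pred {set edge G}) (x : edge_space G) :
  p set0 -> (forall X Y, p X -> p Y -> p (symdiff X Y)) ->
  (x \in <<[seq edge_vec X | X <- enum p]>>%VS) = p (edge_support x).
Proof.
move=> p0 pD; apply/idP/idP => [|px]; last first.
  rewrite -(edge_vec_support x); apply/memv_span/map_f.
  by rewrite mem_enum.
have pz : p (edge_support (0 : edge_space G)).
  by have -> : edge_support (0 : edge_space G) = set0
    by apply/setP => f; rewrite !inE ffunE eqxx.
move=> /(@coord_span _ _ _ (in_tuple _)) ->.
apply: (big_ind (fun y => p (edge_support y))) => // [y z|i _].
  by rewrite edge_support_add; apply: pD.
rewrite (F2_cases (coord _ _ _)); case: (_ != 0); rewrite ?scale0r //.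
rewrite scale1r /=.
have /mapP[X] := mem_nth 0 (ltn_ord i).
by rewrite mem_enum => pX ->; rewrite edge_support_vec.
Qed.

Lemma mem_cycle_space (T : finType) (G : sgraph T) (x : edge_space G) :
  (x \in cycle_space G) = even_edge_set (edge_support x).
Proof.
apply: mem_span_edge_vec => [|X Y /forallP eX /forallP eY]; apply/forallP => v.
  by rewrite (_ : [set _ in _ | _] = set0) ?cards0 //; apply/setP => f; rewrite !inE.
pose S (Z : {set edge G}) := [set f in Z | v \in val f].
have -> : [set f in symdiff X Y | v \in val f] = symdiff (S X) (S Y).
  by apply/setP => f; rewrite !inE; case: (f \in X); case: (f \in Y);
    case: (v \in _).
have -> : #|symdiff (S X) (S Y)| = (#|S X :\: S Y| + #|S Y :\: S X|)%N.
  rewrite cardsU (_ : _ :&: _ = set0) ?cards0 ?subn0 //.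
  by apply/setP => f; rewrite !inE; do 3!case: (_ \in _).
move: (eX v) (eY v); rewrite -/(S X) -/(S Y).
rewrite -(cardsID (S Y) (S X)) -(cardsID (S X) (S Y)) setIC !oddD.
by do 3!case: (odd _).
Qed.

Lemma mem_cut_edge (T : finType) (G : sgraph T) (S : {set T}) (f : edge G)
    (u v : T) : val f = [set u; v] -> (f \in cut G S) = ((u \in S) (+) (v \in S)).
Proof.
move=> fE; rewrite inE; apply/existsP/idP => [[a /existsP[b]]|].
  rewrite fE => /and3P[/eqP E aS bS].
  have: (a \in [set u; v]) && (b \in [set u; v]) by rewrite E !inE !eqxx orbT.
  rewrite !inE => /andP[/orP[]/eqP ea /orP[]/eqP eb]; subst a b; move: aS bS;
    by do 2!case: (_ \in _).
case: (boolP (u \in S)) => uS; case: (boolP (v \in S)) => vS //= _.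
  by exists u; apply/existsP; exists v; rewrite fE eqxx uS vS.
by exists v; apply/existsP; exists u; rewrite fE setUC eqxx uS vS.
Qed.

Lemma mem_cut_space (T : finType) (G : sgraph T) (x : edge_space G) :
  (x \in cut_space G) = is_cut (edge_support x).
Proof.
have eP (f : edge G) : exists u v, val f = [set u; v].
  by have /existsP[u /existsP[v /andP[_ /eqP]]] := valP f; exists u, v.
apply: mem_span_edge_vec => [|X Y /existsP[A /eqP->] /existsP[B /eqP->]];
    apply/existsP.
  exists set0; apply/eqP/setP => f; have [u [v E]] := eP f.
  by rewrite (mem_cut_edge _ E) !inE.
exists (symdiff A B); apply/eqP/setP => f; have [u [v E]] := eP f.
rewrite /symdiff in_setU !in_setD !(mem_cut_edge _ E) !inE.
by do 4!case: (_ \in _).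
Qed.

Lemma mem_bicycle_space (T : finType) (G : sgraph T) (x : edge_space G) :
  (x \in bicycle_space G) =
  even_edge_set (edge_support x) && is_cut (edge_support x).
Proof. by rewrite memv_cap mem_cycle_space mem_cut_space. Qed.

(* Main.v *)
(* Over F_2 the parity Laplacian is D^T D, where D sends a vertex set to its
   cut and D^T sends an edge set to its odd-degree vertices.  Hence D maps
   ker P onto the bicycle space, and ker D, which is contained in ker P,
   contains the functions constant on components; so
   dim ker P >= beta + c.  As ker P and ker (P + I) meet trivially, their
   dimensions add up to at most v. *)
Require Import Defs.
From HB Require Import structures.
From mathcomp Require Import all_boot all_order all_algebra.
Import GRing.Theory.
Local Open Scope ring_scope.

(** A basis of [U], written as the rows of a matrix, is row free and lies in the row space of [K].
    This carries dimensions of subspaces over to matrix ranks. *)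
Lemma dimv_leq_rank (F : fieldType) (m n : nat) (K : 'M[F]_(m, n))
    (U : {vspace 'rV[F]_n}) :
  {in U, forall v, (v <= K)%MS} -> (\dim U <= \rank K)%N.
Proof.
move=> UK; pose B : 'M[F]_(\dim U, n) := \matrix_i (vbasis U)`_i.
have /eqP <- : row_free B.
  apply: inj_row_free => x; rewrite mulmx_sum_row => x0; apply/rowP => i.
  rewrite mxE; have /freeP := basis_free (vbasisP U); apply.
  by rewrite -[RHS]x0; apply: eq_bigr => j _; rewrite rowK.
apply: mxrankS; apply/row_subP => i; rewrite rowK; apply: UK.
by apply/vbasis_mem/mem_nth; rewrite size_tuple.
Qed.

Lemma nullity_add1 (F : fieldType) (n : nat) (M : 'M[F]_n) :
  (nullity M + nullity (M + 1%:M) <= n)%N.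
Proof.
rewrite /nullity -mxrank_disjoint_sum ?rank_leq_col //.
apply/eqP/rowV0P => v; rewrite sub_capmx => /andP[/sub_kermxP v0 /sub_kermxP].
by rewrite linearD /= trmx1 mulmxDr v0 mulmx1 add0r.
Qed.

Section ParityLaplacian.
Variables (T : finType) (G : sgraph T).
Implicit Types (y : 'rV['F_2]_#|T|) (v w : T).

Lemma edge_val (f : edge G) : exists u v, adj G u v /\ val f = [set u; v].
Proof.
by have /existsP[u /existsP[v /andP[uv /eqP]]] := valP f; exists u, v.
Qed.

(** Sending [w] to the pair of [v] and [w] is a bijection from the neighbours of [v] to the edges at
    [v]; it is injective there because [G] has no loops. *)
Lemma sum_edges_at (F : {set T} -> 'F_2) (v : T) :
  \sum_(f : edge G | v \in val f) F (val f) =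
  \sum_(w in [set w | adj G v w]) F [set v; w].
Proof.
rewrite -(big_imset (fun A => F A) (h := fun w => [set v; w])) /=; last first.
  move=> a b; rewrite !inE => va vb /setP/(_ a).
  rewrite !inE eqxx orbT; case: eqP va => [->|_ _ /esym/eqP//].
  by rewrite adj_irr.
rewrite -(big_sub_cond (is_edge G) (fun A => v \in A)).
apply: eq_bigl => A; apply/andP/imsetP => [[]|[w]].
  move=> /existsP[a /existsP[b /andP[ab /eqP->]]]; rewrite !inE.
  case/orP=> /eqP->; first by exists b; rewrite ?inE.
  by exists a; rewrite ?inE 1?adj_sym // setUC.
rewrite inE => vw ->; rewrite !inE eqxx; split=> //.
by apply/existsP; exists v; apply/existsP; exists w; rewrite vw /=.
Qed.

Definition coord_at y v : 'F_2 := y 0 (enum_rank v).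

(** This is the map D. Over F_2 the sum over both ends of an edge is also their difference. *)
Definition coboundary y : edge_space G :=
  [ffun f : edge G => \sum_(u in val f) coord_at y u : ('F_2)^o].

Lemma coboundary_is_linear : linear coboundary.
Proof.
move=> a x y; apply/ffunP => f; rewrite !ffunE /GRing.scale /= big_distrr /=.
by rewrite -big_split; apply: eq_bigr => u _; rewrite /coord_at !mxE.
Qed.
HB.instance Definition _ :=
  GRing.isLinear.Build 'F_2 'rV['F_2]_#|T| (edge_space G) *:%R coboundary
    coboundary_is_linear.

Lemma sum_pair_adj y v w :
  adj G v w -> \sum_(u in [set v; w]) coord_at y u = coord_at y v + coord_at y w.
Proof.
move=> vw; rewrite big_setU1 ?big_set1 // inE.
by apply: contraTneq vw => ->; rewrite adj_irr.
Qed.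

Lemma oppF2 (a : 'F_2) : - a = a.
Proof. by case: a => [[|[|//]] i]; apply/val_inj. Qed.

(** This is P = D^T D, with [y] acting as a column: summing y(v) + y(w) over the edges vw at [v]
    gives deg(v) y(v) plus the values at the neighbours, and signs vanish over F_2. *)
Lemma parity_laplacianE y v :
  coord_at (y *m (parity_laplacian G)^T) v =
  \sum_(f : edge G | v \in val f) coboundary y f.
Proof.
under eq_bigr => f _ do rewrite ffunE.
rewrite (sum_edges_at (fun A => \sum_(u in A) coord_at y u)).
under eq_bigr => w do rewrite inE => /(sum_pair_adj y) ->.
rewrite big_split sumr_const /= /coord_at mxE.
under [LHS]eq_bigr => j _ do rewrite !mxE enum_rankK rmorphB mulrBr /=.
rewrite big_split /=; congr (_ + _).
  rewrite (bigD1 (enum_rank v)) //= big1 => [|j /negPf jv].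
    by rewrite eqxx mulr1n addr0 mulr_natr.
  by rewrite eq_sym jv mulr0n mulr0.
rewrite (reindex_onto (@enum_rank T) enum_val) => [|i _]; last by rewrite enum_valK.
rewrite [RHS]big_mkcond; under eq_bigl => w do rewrite enum_rankK eqxx.
apply: eq_bigr => w _; rewrite inE enum_rankK oppF2.
by case: adj; rewrite ?mulr1 ?mulr0.
Qed.

Lemma natrF2_eq0 (n : nat) : (n%:R == 0 :> 'F_2) = ~~ odd n.
Proof. by rewrite -(dvdn_pcharf (pchar_Fp (isT : prime 2))) dvdn2. Qed.

Lemma even_edge_setE (x : edge_space G) :
  even_edge_set (edge_support x) =
  [forall v, \sum_(f : edge G | v \in val f) x f == 0].
Proof.
apply: eq_forallb => v; rewrite -natrF2_eq0 -sum1_card natr_sum.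
rewrite big_mkcond [in RHS]big_mkcond; congr (_ == _); apply: eq_bigr => f _.
rewrite !inE andbC; case: (v \in val f) => //=.
by rewrite [RHS]F2_cases; case: (x f != 0).
Qed.

(** Every vector over F_2 is the characteristic vector of its support, and D sends it to the cut of
    that support. *)
Lemma cut_spaceP (x : edge_space G) :
  reflect (exists y, x = coboundary y) (x \in cut_space G).
Proof.
rewrite mem_cut_space; apply: (iffP existsP) => [[S /eqP xS]|[y ->]].
  exists (\row_i (enum_val i \in S)%:R); rewrite -(edge_vec_support x) xS.
  apply/ffunP => f; have [u [v [uv fE]]] := edge_val f.
  rewrite !ffunE fE sum_pair_adj // (mem_cut_edge _ fE) /coord_at !mxE !enum_rankK.
  by case: (u \in S); case: (v \in S); apply/val_inj.
exists [set v | coord_at y v != 0]; apply/eqP/setP => f.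
have [u [v [uv fE]]] := edge_val f.
rewrite (mem_cut_edge _ fE) !inE ffunE fE sum_pair_adj //.
rewrite [X in X + _]F2_cases [X in _ + X]F2_cases.
by case: (coord_at y u != 0); case: (coord_at y v != 0).
Qed.

Let kerP : {vspace 'rV['F_2]_#|T|} :=
  lker (linfun (mulmxr (parity_laplacian G)^T)).

Lemma bicycle_space_sub : (bicycle_space G <= linfun coboundary @: kerP)%VS.
Proof.
apply/subvP => x; rewrite memv_cap mem_cycle_space even_edge_setE.
case/andP=> /forallP ev /cut_spaceP[y xy].
(* Evenness of x = D y says D^T D y = 0, so [y] itself lies in ker P. *)
rewrite xy -(lfunE coboundary) memv_img // memv_ker lfunE /=.
apply/eqP/rowP => i; rewrite -[i]enum_valK [RHS]mxE.
by rewrite -[LHS]/(coord_at _ _) parity_laplacianE -xy; apply/eqP.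
Qed.

Lemma lker_coboundary_sub : (lker (linfun coboundary) <= kerP)%VS.
Proof.
apply/subvP => y; rewrite !memv_ker !lfunE /= => /eqP y0.
apply/eqP/rowP => i; rewrite -[i]enum_valK [RHS]mxE.
rewrite -[LHS]/(coord_at _ _) parity_laplacianE y0.
by apply: big1 => f _; rewrite ffunE.
Qed.

Lemma adj_connect_sym : connect_sym (adj G).
Proof. by apply: sym_connect_sym; apply: adj_sym. Qed.

(** Components are represented by their canonical roots, which are what [n_comp] counts. *)
Let component := {r : T | roots (adj G) r}.

Definition component_of v : component :=
  Sub (fingraph.root (adj G) v) (roots_root adj_connect_sym v).

(** The rows are the characteristic vectors of the components. *)
Definition component_row : 'M['F_2]_(#|{: component}|, #|T|) :=
  \matrix_(k, i) (k == enum_rank (component_of (enum_val i)))%:R.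

Lemma mul_component_row (x : 'rV['F_2]_#|{: component}|) v :
  coord_at (x *m component_row) v = x 0 (enum_rank (component_of v)).
Proof.
rewrite /coord_at mxE (bigD1 (enum_rank (component_of v))) //= mxE enum_rankK.
rewrite eqxx mulr1 big1 ?addr0 // => k /negPf kv.
by rewrite mxE enum_rankK kv mulr0.
Qed.

Lemma num_components_leq :
  (num_components G <= \dim (lker (linfun coboundary)))%N.
Proof.
have -> : num_components G = \dim {: 'rV['F_2]_#|{: component}|}.
  rewrite dimvf /dim /= mul1n card_sig.
  by apply: eq_card => v; rewrite !inE andbT.
rewrite -(limg_dim_eq (f := linfun (mulmxr component_row))); last first.
  apply/eqP; rewrite capfv -subv0; apply/subvP => x.
  rewrite memv_ker lfunE memv0 /= => /eqP x0; apply/eqP/rowP => k.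
  (* Injectivity: the value at the root of component [k] recovers the coefficient [x 0 k]. *)
  have := mul_component_row x (val (enum_val k)).
  rewrite x0 /coord_at !mxE => ->; congr (x 0 _).
  rewrite -[LHS]enum_valK; congr enum_rank; apply/val_inj => /=.
  by apply/esym/eqP; apply: (valP (enum_val k)).
apply: dimvS; apply/subvP => _ /memv_imgP[x _ ->].
rewrite memv_ker !lfunE /=; apply/eqP/ffunP => f; rewrite !ffunE.
(* The ends of an edge share a component, so their two values coincide and cancel over F_2. *)
have [u [v [uv ->]]] := edge_val f; rewrite sum_pair_adj // !mul_component_row.
have -> : component_of u = component_of v.
  by apply/val_inj/eqP; rewrite /= (root_connect adj_connect_sym) connect1.
by rewrite -[X in _ + X]oppF2 subrr.
Qed.

(** Rank-nullity for D restricted to ker P: the kernel has dimension at least c, and the image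
    contains the bicycle space. *)
Lemma bicycle_components_leq :
  (bicycle_dim G + num_components G <= nullity (parity_laplacian G))%N.
Proof.
apply: (@leq_trans (\dim kerP)).
  rewrite -(limg_ker_dim (linfun coboundary)) addnC.
  rewrite (capv_idPr lker_coboundary_sub) leq_add ?num_components_leq //.
  exact: dimvS bicycle_space_sub.
apply: dimv_leq_rank => v; rewrite memv_ker lfunE => /eqP v0.
exact/sub_kermxP.
Qed.

End ParityLaplacian.

Theorem theorem10 (T : finType) (G : sgraph T) :
  (nullity2_PI G)%:Z <=
    (num_vertices G)%:Z - (bicycle_dim G)%:Z - (num_components G)%:Z.
Proof.
rewrite -addrA -opprD Num.Theory.lerBrDr -!PoszD lez_nat addnC.
apply: leq_trans (nullity_add1 _ _ (parity_laplacian G)).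
by rewrite leq_add2r bicycle_components_leq.
Qed.
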